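(* Let $V,H$ be Hilbert spaces over $\mathbb{K}=\mathbb{R}$ or $\mathbb{C}$, let $j:V\to H$ be a bounded linear operator with dense range, and let $a:V\times V\to\mathbb{K}$ be a continuous sesquilinear form such that: if $u\in\ker j$ and $a(u,v)=0$ for all $v\in\ker j$, then $u=0$. Let $A$ be the operator on $H$ associated with $(a,j)$, and for $\lambda\in\mathbb{K}$ let $a_\lambda(u,v)=a(u,v)-\lambda\langle j(u),j(v)\rangle_H$. Assume that there exists $\lambda\in\mathbb{K}$ such that $a_\lambda$ is essentially coercive. Then $$\sigma(A)\subset\overline{W(a,j)}\quad\text{and}\quad \|R(\mu,A)\|\le\frac{1}{\operatorname{dist}(\mu,W(a,j))}\ \text{ for all } \mu\in\mathbb{K}\setminus\overline{W(a,j)}.$$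
   Context: The operator $A$ associated with $(a,j)$ is the (well-defined, single-valued) operator on $H$ with graph $\{(x,f)\in H\times H:\exists u\in V,\ j(u)=x \text{ and } a(u,v)=\langle f,j(v)\rangle_H \text{ for all } v\in V\}$. The numerical range of $(a,j)$ is $W(a,j):=\{a(u,u):u\in V,\ \|j(u)\|_H=1\}\subset\mathbb{K}$. A continuous sesquilinear form $b:V\times V\to\mathbb{K}$ is essentially coercive if, for every sequence $(u_n)$ in $V$, $u_n\rightharpoonup 0$ weakly in $V$ and $b(u_n,u_n)\to 0$ imply $\|u_n\|_V\to 0$. $\rho(A)\subset\mathbb{K}$ is the resolvent set of $A$, $\sigma(A)=\mathbb{K}\setminus\rho(A)$ its spectrum, and $R(\mu,A)=(\mu\,\mathrm{Id}-A)^{-1}$ for $\mu\in\rho(A)$. *)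

(* Defs.v *)
From HB Require Import structures.
From mathcomp Require Import all_boot all_order all_algebra.
From mathcomp Require Import all_classical all_reals all_analysis.
From mathcomp Require Export sesquilinear.
From mathcomp Require Import complex.
Set Implicit Arguments.
Unset Strict Implicit.
Unset Printing Implicit Defensive.
Import Order.TTheory GRing.Theory Num.Theory.
Import numFieldNormedType.Exports.
Local Open Scope classical_set_scope.
Local Open Scope ring_scope.

Inductive scalar_kind := RealScalars | ComplexScalars.

(* The scalar field K, either R or C = R[i], with its conjugation and its real
   part.  Norms in a normedModType over K take their values in K, so [scalar_re] is
   also what turns a norm (a nonnegative real element of K) into an element
   of R. *)
Definition scalars (R : realType) (k : scalar_kind) : numFieldType :=
  match k with
  | RealScalars => R : numFieldType
  | ComplexScalars => R[i] : numFieldType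
  end.

Definition scalar_conj (R : realType) (k : scalar_kind) :
    scalars R k -> scalars R k :=
  match k with
  | RealScalars => fun x => x
  | ComplexScalars => fun z => Num.conj (z : R[i])
  end.

Definition scalar_re (R : realType) (k : scalar_kind) : scalars R k -> R :=
  match k with
  | RealScalars => fun x => x
  | ComplexScalars => fun z => complex.Re (z : R[i])
  end.

(* [{dot V for theta}] is linear in its first argument, theta-linear in the
   second one, theta-hermitian and positive definite. *)
HB.mixin Record CompleteNormedModule_isHilbert (R : realType) (k : scalar_kind)
    V of CompleteNormedModule (scalars R k) V := {
  inner : {dot V for @scalar_conj R k};
  innerxx : forall x : V, inner x x = `|x| ^+ 2
}.

#[short(type="hilbertType")]
HB.structure Definition Hilbert (R : realType) (k : scalar_kind) :=
  {V of CompleteNormedModule (scalars R k) V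
      & CompleteNormedModule_isHilbert R k V}.

Section Forms.
Context {R : realType} {k : scalar_kind}.
Local Notation K := (scalars R k).

Definition sesquilinear_form (V : hilbertType R k) :=
  {bilinear V -> V -> K | *%R & @scalar_conj R k \; *%R}.

Definition weakly_cvg (V : hilbertType R k) (u : nat -> V) (x : V) :=
  forall phi : {scalar V}, continuous (phi : V -> K) ->
    phi (u n) @[n --> \oo] --> phi x.

Definition essentially_coercive (V : hilbertType R k) (b : V -> V -> K) :=
  forall u : nat -> V, weakly_cvg u 0 ->
    b (u n) (u n) @[n --> \oo] --> (0 : K) ->
    `|u n| @[n --> \oo] --> (0 : K).

Definition shifted_form (V H : hilbertType R k) (a : V -> V -> K)
    (j : V -> H) (lambda : K) : V -> V -> K :=
  fun u v => a u v - lambda * inner (j u) (j v).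

Definition numerical_range (V H : hilbertType R k) (a : V -> V -> K)
    (j : V -> H) : set K :=
  [set a u u | u in [set u | `|j u| = 1]].

(* Operators on H are represented by their graphs. *)
Definition associated_operator (V H : hilbertType R k) (a : V -> V -> K)
    (j : V -> H) : set (H * H) :=
  [set xf | exists u : V,
     j u = xf.1 /\ forall v : V, a u v = inner xf.2 (j v)].

(* The graph of mu Id - A. *)
Definition mu_minus (H : hilbertType R k) (mu : K) (A : set (H * H)) :
    set (H * H) :=
  [set xf | exists2 y : H, A (xf.1, y) & xf.2 = mu *: xf.1 - y].

(* mu Id - A has a bounded, everywhere defined inverse T. *)
Definition resolvent_set (H : hilbertType R k) (A : set (H * H)) : set K :=
  [set mu | exists2 T : {linear H -> H}, continuous T &
     forall f x : H, T f = x <-> mu_minus mu A (x, f)].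

Definition spectrum (H : hilbertType R k) (A : set (H * H)) : set K :=
  ~` resolvent_set A.

(* (mu Id - A)^-1; meaningful only for mu in the resolvent set. *)
Definition resolvent (H : hilbertType R k) (mu : K) (A : set (H * H)) : H -> H :=
  fun f => xget 0 [set x | mu_minus mu A (x, f)].

Definition operator_norm (H : hilbertType R k) (T : H -> H) : \bar R :=
  ereal_sup [set (scalar_re `|T f|)%:E | f in [set f : H | `|f| <= 1]].

(* The distance to the empty set is +oo. *)
Definition dist_to (mu : K) (W : set K) : \bar R :=
  ereal_inf [set (scalar_re `|mu - w|)%:E | w in W].

End Forms.

(* Main.v *)
(* Let mu lie outside the closure of W(a,j) and let b = a_mu.  For some
   delta > 0, delta |j u|^2 <= |b(u,u)| for all u.  If (u_n) is orthonormal
   (hence weakly null, by Bessel) and b(u_n,u_n) -> 0, then j u_n -> 0, so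
   a_lambda(u_n,u_n) -> 0 and essential coercivity gives |u_n| -> 0, which is
   absurd.  An inductive choice of such a sequence must therefore stop, so b is
   coercive on the orthogonal complement of some finite orthonormal family e.
   Lax-Milgram there reduces b(u,.) = phi on V to a square linear system
   indexed by e.  The form b is nondegenerate: if b(u,.) = 0 then j u = 0, and
   then u = 0 by the hypothesis on ker j.  So the system is injective, hence
   solvable.  This gives surjectivity of mu - A, and
   delta |j u|^2 <= |b(u,u)| gives the resolvent estimate. *)

Require Import Defs.
From HB Require Import structures.
From mathcomp Require Import all_boot all_order all_algebra.
From mathcomp Require Import all_classical all_reals all_analysis.
From mathcomp Require Import complex ring.
Set Implicit Arguments.
Unset Strict Implicit.
Unset Printing Implicit Defensive.
Import Order.TTheory GRing.Theory Num.Theory.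
Import numFieldNormedType.Exports.
Local Open Scope classical_set_scope.
Local Open Scope ring_scope.

Section Scalars.
Context {R : realType} {k : scalar_kind}.
Local Notation K := (scalars R k).
Local Notation conj := (@scalar_conj R k).
Local Notation re := (@scalar_re R k).

Definition scalar_emb : R -> K :=
  match k return R -> scalars R k with
  | RealScalars => fun x => x
  | ComplexScalars => fun x => (x%:C)%C
  end.

Lemma scalar_conjM x y : conj (x * y) = conj x * conj y.
Proof. by case: k x y => // x y; exact: (rmorphM (@Num.conj R[i])). Qed.

Lemma scalar_conjK x : conj (conj x) = x.
Proof. by case: k x => // x; exact: (@conjCK R[i]). Qed.

Lemma mul_scalar_conj x : x * conj x = `|x| ^+ 2.
Proof.
case: k x => x /=; last by rewrite (@normCK R[i]).
by rewrite real_normK ?num_real// expr2.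
Qed.

Lemma scalar_conj_ge0 x : 0 <= x -> conj x = x.
Proof.
by case: k x => // x x0; apply: (@geC0_conj R[i]).
Qed.

Lemma scalar_embD x y : scalar_emb (x + y) = scalar_emb x + scalar_emb y.
Proof. by rewrite /scalar_emb; case: k => //; rewrite rmorphD. Qed.

Lemma scalar_embM x y : scalar_emb (x * y) = scalar_emb x * scalar_emb y.
Proof. by rewrite /scalar_emb; case: k => //; rewrite rmorphM. Qed.

Lemma scalar_emb_nat n : scalar_emb n%:R = n%:R.
Proof. by rewrite /scalar_emb; case: k => //; rewrite rmorph_nat. Qed.

Lemma ler_scalar_emb x y : (scalar_emb x <= scalar_emb y) = (x <= y).
Proof. by rewrite /scalar_emb; case: k => //=; rewrite lecE/= eqxx. Qed.

Lemma ltr_scalar_emb x y : (scalar_emb x < scalar_emb y) = (x < y).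
Proof. by rewrite /scalar_emb; case: k => //=; rewrite ltcE/= eqxx. Qed.

Lemma scalar_reK x : 0 <= x -> scalar_emb (re x) = x.
Proof.
rewrite /scalar_emb; case: k x => //= x x0.
by rewrite RRe_real// ger0_real.
Qed.

Lemma scalar_emb_ge0 x : (0 <= scalar_emb x) = (0 <= x).
Proof. by rewrite -(ler_scalar_emb 0) (scalar_emb_nat 0). Qed.

Lemma scalar_emb_gt0 x : (0 < scalar_emb x) = (0 < x).
Proof. by rewrite -(ltr_scalar_emb 0) (scalar_emb_nat 0). Qed.

Lemma ler_scalar_re x y : 0 <= x -> 0 <= y -> (re x <= re y) = (x <= y).
Proof. by move=> x0 y0; rewrite -ler_scalar_emb !scalar_reK. Qed.

Lemma scalar_archi (e : K) : 0 < e -> exists n, n.+1%:R^-1 < e.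
Proof.
move=> e0; have re0 : 0 < re e by rewrite -scalar_emb_gt0 scalar_reK ?ltW.
have [n] := ltr_add_invr re0; rewrite add0r => ne; exists n.
rewrite -[_^-1]mul1r ltr_pdivrMr ?ltr0n// -[e]scalar_reK ?ltW//.
rewrite -(scalar_emb_nat n.+1) -scalar_embM -[X in X < _](scalar_emb_nat 1).
by rewrite ltr_scalar_emb -ltr_pdivrMr ?ltr0n// mul1r.
Qed.

Lemma scalar_inf (A : set K) : A !=set0 -> (forall x, A x -> 0 <= x) ->
  exists d : K, [/\ 0 <= d, forall x, A x -> d <= x &
    forall e, 0 < e -> exists2 x, A x & x < d + e].
Proof.
move=> [x0 Ax0] A0; pose B := [set re x | x in A].
have B0 : B !=set0 by exists (re x0), x0.
have lbB : has_lbound B.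
  by exists 0 => _ [x Ax <-]; rewrite -scalar_emb_ge0 scalar_reK ?A0.
exists (scalar_emb (inf B)); split.
- rewrite scalar_emb_ge0; apply: lb_le_inf => // _ [x Ax <-].
  by rewrite -scalar_emb_ge0 scalar_reK ?A0.
- move=> x Ax; rewrite -[x]scalar_reK ?A0// ler_scalar_emb.
  by apply: ge_inf => //; exists x.
- move=> e e0; have re0 : 0 < re e by rewrite -scalar_emb_gt0 scalar_reK ?ltW.
  have [_ [x Ax <-] xlt] := inf_adherent re0 (Logic.conj B0 lbB).
  exists x => //; rewrite -[x]scalar_reK ?A0// -[e]scalar_reK ?ltW//.
  by rewrite -scalar_embD ltr_scalar_emb.
Qed.

Lemma scalar_conj0 : conj 0 = 0.
Proof. by rewrite scalar_conj_ge0. Qed.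
End Scalars.

Section Sequences.
Context {R : realType} {k : scalar_kind}.
Local Notation K := (scalars R k).

Lemma cvg_seqP (W : normedModType K) (u : nat -> W) (l : W) :
  u n @[n --> \oo] --> l <->
  forall e : K, 0 < e -> exists N, forall n, (N <= n)%N -> `|l - u n| < e.
Proof.
split=> [/cvgrPdist_lt h e /h[N _ hN]|h]; first by exists N.
by apply/cvgrPdist_lt => e /h[N hN]; exists N.
Qed.

Lemma cauchy_seq_cvg (V : hilbertType R k) (u : nat -> V) :
  (forall e : K, 0 < e -> exists N,
     forall m n, (N <= m)%N -> (N <= n)%N -> `|u m - u n| < e) ->
  exists l : V, u n @[n --> \oo] --> l.
Proof.
move=> h; have cu : cauchy (u @ \oo); last first.
  exact: (cvg_ex _).1 ((cauchy_cvgP _).1 cu).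
apply: cauchy_exP => e /h[N hN]; exists (u N); exists N => // n /= Nn.
by rewrite -ball_normE /=; apply: hN.
Qed.
End Sequences.

Section Sesquilinear.
Context {R : realType} {k : scalar_kind} {V : hilbertType R k}.
Local Notation K := (scalars R k).
Local Notation conj := (@scalar_conj R k).

Definition antilinear (phi : V -> K) :=
  forall t u v, phi (t *: u + v) = conj t * phi u + phi v.

Definition bounded_functional (phi : V -> K) :=
  exists2 M, 0 <= M & forall v, `|phi v| <= M * `|v|.

Definition sesquilinear (b : V -> V -> K) :=
  (forall t u u' v, b (t *: u + u') v = t * b u v + b u' v) /\
  (forall u, antilinear (b u)).

Definition bounded_form (b : V -> V -> K) :=
  exists2 M, 0 <= M & forall u v, `|b u v| <= M * `|u| * `|v|.

Section Antilinear.
Variables (phi : V -> K) (phiP : antilinear phi).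

Lemma antilinear0 : phi 0 = 0.
Proof.
have := phiP 1 0 0; rewrite scaler0 add0r.
by rewrite scalar_conj_ge0// mul1r -{1}[phi 0]add0r => /addIr.
Qed.

Lemma antilinearZ t v : phi (t *: v) = conj t * phi v.
Proof. by rewrite -[t *: v]addr0 phiP antilinear0 addr0. Qed.

Lemma antilinearD u v : phi (u + v) = phi u + phi v.
Proof. by rewrite -[u]scale1r phiP scalar_conj_ge0// mul1r scale1r. Qed.

Lemma antilinearB u v : phi (u - v) = phi u - phi v.
Proof. by apply/(canRL (addrK _)); rewrite -antilinearD subrK. Qed.

Lemma antilinear_sum I (r : seq I) (F : I -> V) :
  phi (\sum_(i <- r) F i) = \sum_(i <- r) phi (F i).
Proof.
elim: r => [|i r IH]; first by rewrite !big_nil antilinear0.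
by rewrite !big_cons antilinearD IH.
Qed.

Lemma cvg_antilinear (u : nat -> V) l : bounded_functional phi ->
  u n @[n --> \oo] --> l -> phi (u n) @[n --> \oo] --> phi l.
Proof.
move=> [M M0 phiM] /cvg_seqP ul; apply/cvg_seqP => e e0.
have c0 : 0 < M + 1 by rewrite ltr_wpDl.
have [N hN] := ul _ (divr_gt0 e0 c0); exists N => n /hN.
rewrite ltr_pdivlMr// -antilinearB; apply: le_lt_trans.
by apply: le_trans (phiM _) _; rewrite mulrDr mulr1 mulrC lerDl.
Qed.
End Antilinear.

Section Theory.
Variables (b : V -> V -> K) (bs : sesquilinear b).

Lemma sesqui0l v : b 0 v = 0.
Proof. by have := bs.1 (-1) 0 0 v; rewrite scaler0 addr0 mulN1r addNr. Qed.

Lemma sesquiDl u u' v : b (u + u') v = b u v + b u' v.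
Proof. by rewrite -{1}[u]scale1r bs.1 mul1r. Qed.

Lemma sesquiZl t u v : b (t *: u) v = t * b u v.
Proof. by rewrite -[t *: u]addr0 bs.1 sesqui0l addr0. Qed.

Lemma sesquiBl u u' v : b (u - u') v = b u v - b u' v.
Proof. by rewrite sesquiDl -scaleN1r sesquiZl mulN1r. Qed.

Lemma sesqui_suml I (r : seq I) (F : I -> V) v :
  b (\sum_(i <- r) F i) v = \sum_(i <- r) b (F i) v.
Proof.
elim: r => [|i r IH]; first by rewrite !big_nil sesqui0l.
by rewrite !big_cons sesquiDl IH.
Qed.

Lemma cvg_sesquil (u : nat -> V) l v : bounded_form b ->
  u n @[n --> \oo] --> l -> b (u n) v @[n --> \oo] --> b l v.
Proof.
move=> [M M0 bM] /cvg_seqP ul; apply/cvg_seqP => e e0.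
have c0 : 0 < M * `|v| + 1 by rewrite ltr_wpDl// mulr_ge0.
have [N hN] := ul _ (divr_gt0 e0 c0); exists N => n /hN.
rewrite ltr_pdivlMr// -sesquiBl; apply: le_lt_trans.
apply: le_trans (bM _ _) _; rewrite mulrDr mulr1.
by rewrite [M * _]mulrC -mulrA lerDl.
Qed.

Lemma bounded_form_functional u : bounded_form b -> bounded_functional (b u).
Proof.
by move=> [M M0 bM]; exists (M * `|u|) => [|v]; [rewrite mulr_ge0|exact: bM].
Qed.
End Theory.

Lemma innerC (u v : V) : inner u v = conj (inner v u).
Proof.
have := @hermitian_subproof _ _ _ _ (inner : {dot V for conj}) u v.
by rewrite expr0 mul1r.
Qed.

Lemma inner_sesquilinear : sesquilinear (@inner R k V).
Proof.
by split=> [t u u' v|u t v v']; [rewrite linearPl|rewrite linearPr].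
Qed.

Lemma norm_sub_proj (y s : V) : s != 0 ->
  `|y - (inner y s / `|s| ^+ 2) *: s| ^+ 2 =
  `|y| ^+ 2 - `|inner y s| ^+ 2 / `|s| ^+ 2.
Proof.
move=> s0; have n0 : `|s| ^+ 2 != 0 by rewrite expf_eq0/= normr_eq0.
set t := inner y s / _.
have tc : conj t = conj (inner y s) / `|s| ^+ 2.
  by rewrite scalar_conjM [conj _^-1]scalar_conj_ge0// invr_ge0 exprn_ge0.
have S := inner_sesquilinear.
rewrite -innerxx (sesquiBl S) !(antilinearB (S.2 _)) !(sesquiZl S).
rewrite !(antilinearZ (S.2 _)) [inner s y]innerC !innerxx tc -mul_scalar_conj /t.
move: n0; move: (`|y| ^+ 2) (`|s| ^+ 2) (inner y s) (conj _) => Y n c d n0.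
by rewrite divfK// subrr subr0 mulrAC [d * c]mulrC.
Qed.

Lemma cauchy_schwarz (u v : V) : `|inner u v| <= `|u| * `|v|.
Proof.
have [->|v0] := eqVneq v 0.
  by rewrite (antilinear0 (inner_sesquilinear.2 _)) !normr0 mulr0.
have n0 : 0 < `|v| by rewrite normr_gt0.
rewrite -(@ler_pXn2r _ 2)// ?nnegrE ?mulr_ge0// exprMn -ler_pdivrMr ?exprn_gt0//.
by rewrite -subr_ge0 -norm_sub_proj// exprn_ge0.
Qed.

Lemma inner_bounded : bounded_form (@inner R k V).
Proof. by exists 1 => // u v; rewrite mul1r cauchy_schwarz. Qed.

Lemma parallelogram (u v : V) :
  `|u - v| ^+ 2 + `|u + v| ^+ 2 = (`|u| ^+ 2 + `|v| ^+ 2) *+ 2.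
Proof.
have S := inner_sesquilinear.
rewrite -!innerxx (sesquiBl S) (sesquiDl S) !(antilinearB (S.2 _)).
rewrite !(antilinearD (S.2 _)) mulr2n.
have E (F : fieldType) (a b c d : F) :
  a - b - (c - d) + (a + b + (c + d)) = a + d + (a + d) by ring.
exact: E.
Qed.
End Sesquilinear.

Section Projection.
Context {R : realType} {k : scalar_kind} {V : hilbertType R k}.
Local Notation K := (scalars R k).
Local Notation conj := (@scalar_conj R k).
Local Notation innerS := (@inner_sesquilinear R k V).

Definition closed_subspace (S : set V) :=
  [/\ S 0, forall t u v, S u -> S v -> S (t *: u + v) &
      forall (u : nat -> V) l, (forall n, S (u n)) ->
        u n @[n --> \oo] --> l -> S l].

Lemma ler_invS (m n : nat) : (m <= n)%N -> n.+1%:R^-1 <= m.+1%:R^-1 :> K.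
Proof. by move=> mn; rewrite lef_pV2 ?posrE ?ltr0n// ler_nat ltnS. Qed.

Lemma cvg_seq_unique (W : normedModType K) (u : nat -> W) (l l' : W) :
  u n @[n --> \oo] --> l -> u n @[n --> \oo] --> l' -> l = l'.
Proof. by move=> ul ul'; apply: (cvg_unique _ ul ul'); exact: norm_hausdorff. Qed.

Lemma exists_projection (S : set V) (x : V) : closed_subspace S ->
  exists2 p, S p & forall s, S s -> inner (x - p) s = 0.
Proof.
move=> [S0 Slin Scl].
have SD u v : S u -> S v -> S (u + v).
  by move=> Su Sv; rewrite -[u]scale1r; apply: Slin.
have SZ t u : S u -> S (t *: u).
  by move=> Su; rewrite -[_ *: _]addr0; apply: Slin.
have [||d [d0 dle dlt]] := @scalar_inf R k [set `|x - s| ^+ 2 | s in S].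
- by exists (`|x - 0| ^+ 2), 0.
- by move=> _ [s Ss <-]; rewrite exprn_ge0.
have dS s : S s -> d <= `|x - s| ^+ 2 by move=> Ss; apply: dle; exists s.
have /choice[s sP] n : exists s, S s /\ `|x - s| ^+ 2 < d + n.+1%:R^-1.
  have [|_ [s Ss <-] sd] := dlt n.+1%:R^-1; first by rewrite invr_gt0 ltr0n.
  by exists s.
have [e e0|p sp] := @cauchy_seq_cvg R k V s.
  have [N Ne] := @scalar_archi R k _ (divr_gt0 (exprn_gt0 2 e0) (ltr0n _ 4)).
  exists N => m n Nm Nn.
  rewrite -(@ltr_pXn2r _ 2)// ?nnegrE ?(ltW e0)//.
  have -> : s m - s n = (x - s n) - (x - s m).
    by rewrite opprB [RHS]addrC addrA subrK.
  have := parallelogram (x - s n) (x - s m).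
  have -> : (x - s n) + (x - s m) = 2%:R *: (x - 2^-1 *: (s n + s m)).
    rewrite scalerBr scalerA divff ?pnatr_eq0// scale1r scaler_nat mulr2n.
    by rewrite opprD addrACA.
  rewrite normrZ exprMn (@ger0_norm _ 2)// => /(canRL (addrK _)) ->.
  rewrite ltrBlDr; apply: (@lt_le_trans _ _ ((d + N.+1%:R^-1) *+ 4)).
    rewrite -[4%N]/(2 * 2)%N mulrnA ltr_pMn2r//.
    rewrite mulr2n; apply: ltrD; apply: lt_le_trans (sP _).2 _;
    by rewrite lerD2l ler_invS.
  rewrite mulrnDl addrC lerD//; last first.
    rewrite -natrX -[d *+ 4]mulr_natl.
    by rewrite ler_pM2l ?ltr0n//; apply/dS/SZ/SD; apply (sP _).1.
  by rewrite -[_ *+ 4]mulr_natr -ler_pdivlMr ?ltr0n// ltW.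
have Sp : S p by apply: Scl sp => n; apply (sP n).1.
(* d <= |x - s n - t v|^2 for the minimizing t bounds |<x - s n, v>|^2 by
   |v|^2 / (n + 1). *)
exists p => // v Sv; have [->|v0] := eqVneq v 0.
  by rewrite (antilinear0 (innerS.2 _)).
apply: (@cvg_seq_unique K^o (fun n => inner (x - s n) v)).
  apply: (@cvg_sesquil _ _ _ inner innerS (fun n => x - s n)).
    exact: inner_bounded.
  by apply: cvgB => //; apply: cvg_cst.
apply/cvg_seqP => e e0.
have v2 : 0 < `|v| ^+ 2 by rewrite exprn_gt0// normr_gt0.
have [N Ne] := @scalar_archi R k _ (divr_gt0 (exprn_gt0 2 e0) v2).
exists N => n Nn; rewrite sub0r normrN -(@ltr_pXn2r _ 2)// ?nnegrE ?(ltW e0)//.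
rewrite ltr_pdivlMr// in Ne.
apply: le_lt_trans Ne; rewrite -ler_pdivrMr//.
apply: (le_trans _ (ler_invS Nn)).
rewrite -(lerD2l d); apply: le_trans (ltW (sP n).2).
rewrite -lerBrDr -norm_sub_proj//.
rewrite -addrA -opprD; apply/dS/SD; first exact: (sP n).1.
exact: SZ.
Qed.
End Projection.

Section LaxMilgram.
Context {R : realType} {k : scalar_kind} {V : hilbertType R k}.
Local Notation K := (scalars R k).
Local Notation conj := (@scalar_conj R k).
Local Notation innerS := (@inner_sesquilinear R k V).
Implicit Types (W : set V) (phi : V -> K) (b : V -> V -> K).

Lemma riesz W phi : closed_subspace W -> antilinear phi ->
  bounded_functional phi ->
  exists2 z, W z & forall v, W v -> inner z v = phi v.
Proof.
move=> [W0 Wlin Wcl] phiP phiB.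
have [phi0|/existsNP[x /not_implyP[Wx /eqP phix]]] :=
    pselect (forall v, W v -> phi v = 0).
  by exists 0 => // v /phi0 ->; rewrite (sesqui0l innerS).
have kerP : closed_subspace (W `&` [set v | phi v = 0]).
  split=> [|t u v [Wu /= pu] [Wv /= pv]|u l uk ul].
  - by split=> //=; rewrite antilinear0.
  - by split; [exact: Wlin|rewrite /= phiP pu pv mulr0 addr0].
  - split; first by apply: Wcl ul => n; have [] := uk n.
    apply: (@cvg_seq_unique _ _ K^o (fun n => phi (u n))).
      exact: cvg_antilinear.
    rewrite (_ : (fun n => phi (u n)) = fun=> 0); first exact: cvg_cst.
    by apply/funext => n; have [] := uk n.
have [p [Wp /= pp] px] := exists_projection x kerP.
set y := x - p in px.
have Wy : W y.
  by rewrite /y addrC -scaleN1r; exact: Wlin.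
have phiy : phi y != 0 by rewrite /y antilinearB// pp subr0.
have y0 : y != 0 by apply: contra_neq phiy => ->; rewrite antilinear0.
have n0 : `|y| ^+ 2 != 0 by rewrite expf_eq0/= normr_eq0.
exists ((phi y / `|y| ^+ 2) *: y) => [|v Wv].
  by rewrite -[_ *: y]addr0; exact: Wlin.
rewrite (sesquiZl innerS).
pose t := conj (phi v / phi y).
have vE : v = t *: y + (v - t *: y) by rewrite addrC subrK.
have -> : inner y v = conj t * `|y| ^+ 2.
  rewrite {1}vE (antilinearD (innerS.2 _)) (antilinearZ (innerS.2 _)) innerxx.
  rewrite px ?addr0//; split.
    by rewrite addrC -scaleNr; exact: Wlin.
  by rewrite /= antilinearB// antilinearZ// scalar_conjK divfK// subrr.
by rewrite mulrA mulrAC divfK// scalar_conjK mulrC divfK.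
Qed.

Lemma lax_milgram W b c phi : closed_subspace W ->
  sesquilinear b -> bounded_form b -> 0 < c ->
  (forall w, W w -> c * `|w| ^+ 2 <= `|b w w|) ->
  antilinear phi -> bounded_functional phi ->
  exists2 w, W w & forall v, W v -> b w v = phi v.
Proof.
move=> Wcs bs bb c0 bc phiP phiB; have [W0 Wlin Wcl] := Wcs.
have [z Wz zphi] := riesz Wcs phiP phiB.
have WB u v : W u -> W v -> W (u - v).
  by move=> Wu Wv; rewrite addrC -scaleN1r; exact: Wlin.
(* G is the graph relating the Riesz representative of b(w,.) to w.  Its range
   is closed since b is bounded below, and its orthogonal complement in W is
   trivial since |<B y, y>| = |b(y,y)| >= c |y|^2. *)
pose G z w := [/\ W z, W w & forall v, W v -> inner z v = b w v].
have Glip z1 w1 z2 w2 : G z1 w1 -> G z2 w2 ->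
    `|w1 - w2| <= c^-1 * `|z1 - z2|.
  move=> [Wz1 Ww1 G1] [Wz2 Ww2 G2].
  have [->|w0] := eqVneq w1 w2.
    by rewrite subrr normr0 mulr_ge0// invr_ge0 ltW.
  have n0 : 0 < `|w1 - w2| by rewrite normr_gt0 subr_eq0.
  rewrite -ler_pdivrMl ?invr_gt0// invrK -(ler_pM2r n0) -mulrA -expr2.
  apply: (le_trans (bc _ (WB _ _ Ww1 Ww2))).
  rewrite (sesquiBl bs) -G1 -?G2; try exact: WB.
  by rewrite -(sesquiBl innerS); exact: cauchy_schwarz.
have rgP : closed_subspace [set z | exists w, G z w].
  split=> [|t u v [w [Wu Ww uw]] [w' [Wv Ww' vw]]|u l /choice[w uw] ul].
  - exists 0; split=> // v Wv.
    by rewrite (sesqui0l innerS) (sesqui0l bs).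
  - exists (t *: w + w'); split; [exact: Wlin|exact: Wlin|move=> s Ws].
    by rewrite innerS.1 bs.1 uw// vw.
  - have [e e0|w' ww'] := @cauchy_seq_cvg R k V w.
      have [N hN] := (cvg_seqP u l).1 ul _ (divr_gt0 (mulr_gt0 c0 e0) (ltr0n _ 2)).
      exists N => m n Nm Nn; apply: (le_lt_trans (Glip _ _ _ _ (uw m) (uw n))).
      rewrite ltr_pdivrMl//.
      have -> : u m - u n = (l - u n) - (l - u m) by rewrite opprB [RHS]addrC addrA subrK.
      apply: (le_lt_trans (ler_normB _ _)); rewrite [ltRHS]splitr.
      by apply: ltrD; exact: hN.
    exists w'; split.
    + by apply: Wcl ul => n; have [] := uw n.
    + by apply: Wcl ww' => n; have [] := uw n.
    + move=> v Wv; apply: (@cvg_seq_unique _ _ K^o (fun n => b (w n) v)).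
        rewrite (_ : (fun n => _) = fun n => inner (u n) v).
          by apply: cvg_sesquil => //; [exact: innerS|exact: inner_bounded].
        by apply/funext => n; have [_ _ ->] := uw n.
      exact: cvg_sesquil.
have [p [w [Wp Ww pw]] zp] := exists_projection z rgP.
exists w => // v Wv; rewrite -pw// -zphi//; suff -> : z = p by [].
have Wy : W (z - p) by exact: WB.
have [z' Wz' z'P] := riesz Wcs (bs.2 (z - p)) (bounded_form_functional _ bb).
have : c * `|z - p| ^+ 2 <= 0.
  apply: (le_trans (bc _ Wy)); rewrite -z'P// innerC zp; last by exists (z - p).
  by rewrite scalar_conj0 normr0.
rewrite pmulr_rle0// real_exprn_even_le0 ?normr_real//= normr_eq0 subr_eq0.
by move=> /eqP.
Qed.
End LaxMilgram.

Section Orthonormal.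
Context {R : realType} {k : scalar_kind} {V : hilbertType R k}.
Local Notation K := (scalars R k).
Local Notation conj := (@scalar_conj R k).
Local Notation innerS := (@inner_sesquilinear R k V).

Definition orthonormal_family (I : eqType) (e : I -> V) :=
  forall i j, inner (e i) (e j) = (i == j)%:R.

Lemma orthonormal_norm (I : eqType) (e : I -> V) i :
  orthonormal_family e -> `|e i| = 1.
Proof.
move=> eP; apply/eqP; rewrite -(@eqrXn2 _ 2)//.
by rewrite -innerxx eP eqxx expr1n.
Qed.

Lemma scalar_functional_bounded (phi : {scalar V}) :
  continuous (phi : V -> K) -> bounded_functional (phi : V -> K).
Proof.
move=> phic.
have /linear_boundedP := @continuous_linear_bounded _ V K^o 0
  (phi : {linear V -> K^o}) (phic 0).
move=> /pinfty_ex_gt0[M M0 hM].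
by exists M; [exact: ltW|exact: hM].
Qed.

Lemma bessel (u : nat -> V) (phi : {scalar V}) M : orthonormal_family u ->
  0 <= M -> (forall v, `|phi v| <= M * `|v|) ->
  forall N, \sum_(n < N) `|phi (u n)| ^+ 2 <= M ^+ 2.
Proof.
move=> uP M0 phiM N; set S := \sum_(n < N) _.
have S0 : 0 <= S by apply: sumr_ge0 => i _; rewrite exprn_ge0.
pose v := \sum_(n < N) conj (phi (u n)) *: u n.
have phiv : phi v = S.
  rewrite linear_sum; apply: eq_bigr => i _.
  by rewrite linearZ/= mulrC mul_scalar_conj.
have uv (m : 'I_N) : inner v (u m) = conj (phi (u m)).
  rewrite (sesqui_suml innerS) (bigD1 m)//= (sesquiZl innerS) uP eqxx mulr1.
  rewrite big1 ?addr0// => i im; rewrite (sesquiZl innerS) uP.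
  by rewrite (negbTE (im : nat_of_ord i != m)) mulr0.
have vS : `|v| ^+ 2 = S.
  rewrite -innerxx {2}/v (antilinear_sum (innerS.2 _)); apply: eq_bigr => i _.
  by rewrite (antilinearZ (innerS.2 _)) uv scalar_conjK mul_scalar_conj.
have [->|Sn0] := eqVneq S 0; first by rewrite exprn_ge0.
have Sgt0 : 0 < S by rewrite lt_def Sn0.
have : S ^+ 2 <= M ^+ 2 * `|v| ^+ 2.
  rewrite -exprMn ler_pXn2r ?nnegrE ?mulr_ge0// -[S]ger0_norm// -phiv.
  exact: phiM.
by rewrite vS expr2 ler_pM2r.
Qed.

Lemma orthonormal_weakly_cvg (u : nat -> V) :
  orthonormal_family u -> weakly_cvg u 0.
Proof.
move=> uP phi /scalar_functional_bounded[M M0 phiM]; rewrite linear0.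
have bes := bessel uP M0 phiM.
pose S N := \sum_(n < N) `|phi (u n)| ^+ 2.
have [||d [d0 dle dlt]] := @scalar_inf R k [set M ^+ 2 - S N | N in setT].
- by exists (M ^+ 2 - S 0%N); exists 0%N.
- by move=> _ [N _ <-]; rewrite subr_ge0; exact: bes.
apply/(@cvg_seqP _ _ K^o) => e e0.
(* The partial sums S n are nondecreasing and M^2 - S N is within e^2 of its
   infimum d, so every later term of the sum is below e^2. *)
have [_ [N _ <-] hN] := dlt _ (exprn_gt0 2 e0).
exists N => n Nn; rewrite sub0r normrN -(@ltr_pXn2r _ 2)// ?nnegrE ?(ltW e0)//.
rewrite -(ltrD2l d); apply: le_lt_trans hN.
have /dle : [set M ^+ 2 - S N | N in setT] (M ^+ 2 - S n.+1) by exists n.+1.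
rewrite /S big_ord_recr/= opprD addrA lerBrDr => /le_trans; apply.
rewrite lerD2l lerN2; have -> : n = (N + (n - N))%N by rewrite subnKC.
rewrite big_split_ord/= lerDl; apply: sumr_ge0 => i _.
by rewrite exprn_ge0.
Qed.

Lemma finite_codim_coercive (b : V -> V -> K) : sesquilinear b ->
  (forall u : nat -> V, orthonormal_family u ->
     ~ (b (u n) (u n) @[n --> \oo] --> (0 : K))) ->
  exists n (e : 'I_n -> V) c, [/\ orthonormal_family e, 0 < c &
    forall w, (forall i, inner w (e i) = 0) -> c * `|w| ^+ 2 <= `|b w w|].
Proof.
move=> bs nob; apply: contrapT => nex.
pose P (s : seq V) := forall i j, (i < size s)%N -> (j < size s)%N ->
  inner s`_i s`_j = (i == j)%:R.
have /choice[F FP] (s : seq V) : exists u, P s ->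
    [/\ inner u u = 1, (forall i, (i < size s)%N -> inner u s`_i = 0) &
        `|b u u| < (size s).+1%:R^-1].
  have [sP|] := pselect (P s); last by exists 0.
  apply: contrapT => nu; apply: nex.
  exists (size s), (fun i => s`_i), (size s).+1%:R^-1; split.
  - by move=> i j; apply: sP.
  - by rewrite invr_gt0 ltr0n.
  move=> w ws; have [->|w0] := eqVneq w 0.
    by rewrite normr0 expr0n/= mulr0.
  have n0 : 0 < `|w| by rewrite normr_gt0.
  rewrite real_leNgt ?normr_real//.
  apply/negP => bw; apply: nu; exists (`|w|^-1 *: w) => _.
  have cn : conj `|w|^-1 = `|w|^-1 by rewrite scalar_conj_ge0// invr_ge0.
  rewrite (sesquiZl innerS) (antilinearZ (innerS.2 _)) cn innerxx.
  rewrite (sesquiZl bs) (antilinearZ (bs.2 _)) cn; split.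
  - by rewrite mulrA -invfM -expr2 mulVf// expf_eq0/= gt_eqF.
  - by move=> i si; rewrite (sesquiZl innerS) (ws (Ordinal si)) mulr0.
  - rewrite mulrA -invfM -expr2 normrM [`|_^-1|]ger0_norm ?invr_ge0 ?exprn_ge0//.
    by rewrite ltr_pdivrMl ?exprn_gt0// mulrC.
pose l n := iter n (fun s => rcons s (F s)) [::].
pose u n := F (l n).
have lu n : l n = mkseq u n.
  elim: n => // n IH; rewrite /l iterS -/(l n) mkseqS -IH.
  by [].
have uF n : P (l n) -> forall m, (m <= n)%N -> inner (u n) (u m) = (n == m)%:R.
  move=> /FP[un1 unF _] m; rewrite leq_eqVlt => /orP[/eqP ->|mn].
    by rewrite eqxx.
  rewrite gtn_eqF// -(nth_mkseq 0 u mn) -lu; apply: unF.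
  by rewrite lu size_mkseq.
have symE m n : inner (u m) (u n) = (m == n)%:R -> inner (u n) (u m) = (n == m)%:R.
  move=> h; rewrite innerC h eq_sym scalar_conj_ge0//.
have Pl n : P (l n).
  elim: n => [|n IH]; first by [].
  move=> i j; rewrite lu size_mkseq => ilt jlt; rewrite !nth_mkseq//.
  move: ilt jlt; rewrite !ltnS leq_eqVlt => /orP[/eqP ->|iln].
    exact: uF.
  rewrite leq_eqVlt => /orP[/eqP ->|jln].
    by apply: symE; apply: uF => //; exact: ltnW.
  by have := IH i j; rewrite lu size_mkseq !nth_mkseq//; apply.
apply: (nob u).
  move=> m n; have [mn|/ltnW nm] := leqP n m; first exact: uF.
  by apply: symE; exact: uF.
apply/(@cvg_seqP _ _ K^o) => e /scalar_archi[N Ne].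
exists N => n Nn; rewrite sub0r normrN.
have [_ _] := FP _ (Pl n); rewrite lu size_mkseq -lu => h.
apply: lt_trans Ne; apply: lt_le_trans h _; exact: ler_invS.
Qed.
End Orthonormal.

Section Solve.
Context {R : realType} {k : scalar_kind} {V : hilbertType R k}.
Local Notation K := (scalars R k).
Local Notation conj := (@scalar_conj R k).
Local Notation innerS := (@inner_sesquilinear R k V).

Lemma closed_subspace_orthogonal n (e : 'I_n -> V) :
  closed_subspace [set w | forall i, inner w (e i) = 0].
Proof.
split=> [i|t u v uP vP i|u l uP ul i] /=.
- by rewrite (sesqui0l innerS).
- by rewrite innerS.1 uP vP mulr0 addr0.
- apply: (@cvg_seq_unique _ _ K^o (fun n => inner (u n) (e i))).
    by apply: cvg_sesquil => //; [exact: innerS|exact: inner_bounded].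
  rewrite (_ : (fun n => _) = fun=> 0); first exact: cvg_cst.
  by apply/funext => m; rewrite uP.
Qed.

Lemma antilinear_eq n (e : 'I_n -> V) (phi psi : V -> K) :
  orthonormal_family e -> antilinear phi -> antilinear psi ->
  (forall i, phi (e i) = psi (e i)) ->
  (forall w, (forall i, inner w (e i) = 0) -> phi w = psi w) ->
  forall v, phi v = psi v.
Proof.
move=> eP phiP psiP phie phiw v.
pose p := \sum_i inner v (e i) *: e i.
have -> : v = p + (v - p) by rewrite addrC subrK.
rewrite antilinearD// [RHS]antilinearD//; congr (_ + _).
  rewrite !antilinear_sum//; apply: eq_bigr => i _.
  by rewrite antilinearZ// phie antilinearZ.
apply: phiw => i; rewrite (sesquiBl innerS) (sesqui_suml innerS) (bigD1 i)//=.
rewrite (sesquiZl innerS) eP eqxx mulr1 big1 ?addr0 ?subrr// => m mi.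
by rewrite (sesquiZl innerS) eP (negbTE mi) mulr0.
Qed.

Lemma form_surjective n (e : 'I_n -> V) (b : V -> V -> K) c (phi : V -> K) :
  sesquilinear b -> bounded_form b ->
  orthonormal_family e -> 0 < c ->
  (forall w, (forall i, inner w (e i) = 0) -> c * `|w| ^+ 2 <= `|b w w|) ->
  (forall u, (forall v, b u v = 0) -> u = 0) ->
  antilinear phi -> bounded_functional phi ->
  exists u, forall v, b u v = phi v.
Proof.
move=> bs bb eP c0 bc binj phiP phiB.
have We := closed_subspace_orthogonal e.
have [w0 _ w0P] := lax_milgram We bs bb c0 bc phiP phiB.
have /choice[w wP] i : exists w, (forall j, inner w (e j) = 0) /\
    forall v, (forall j, inner v (e j) = 0) -> b w v = b (e i) v.
  have [w Ww wP] := lax_milgram We bs bb c0 bc (bs.2 (e i))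
    (bounded_form_functional (e i) bb).
  by exists w.
(* b(g i,.) vanishes on the orthogonal complement of e, so adding combinations
   of the g i to w0 only changes the values at the e m. *)
pose g i := e i - w i.
have gW (x : 'rV[K]_n) v : (forall j, inner v (e j) = 0) ->
    b (\sum_i x 0 i *: g i) v = 0.
  move=> Wv; rewrite sesqui_suml// big1// => i _.
  by rewrite sesquiZl// sesquiBl// (wP i).2// subrr mulr0.
pose M : 'M[K]_n := \matrix_(i, m) b (g i) (e m).
have gM (x : 'rV[K]_n) m : b (\sum_i x 0 i *: g i) (e m) = (x *m M) 0 m.
  rewrite sesqui_suml// mxE; apply: eq_bigr => i _.
  by rewrite sesquiZl// mxE.
have Mu : M \in unitmx.
  rewrite -row_free_unit; apply: inj_row_free => x xM.
  have u0 : \sum_i x 0 i *: g i = 0.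
    apply: binj; apply: (antilinear_eq (psi := fun=> 0) eP) => //.
    - exact: bs.2.
    - by move=> t u v; rewrite mulr0 addr0.
    - by move=> m; rewrite gM xM mxE.
    - exact: gW.
  apply/rowP => m; rewrite mxE -(sesqui0l innerS (e m)) -u0.
  rewrite (sesqui_suml innerS) (bigD1 m)//= (sesquiZl innerS) (sesquiBl innerS).
  rewrite (wP m).1 subr0 eP eqxx mulr1 big1 ?addr0// => i im.
  by rewrite (sesquiZl innerS) (sesquiBl innerS) (wP i).1 subr0 eP (negbTE im) mulr0.
pose r : 'rV[K]_n := \row_m (phi (e m) - b w0 (e m)).
pose x := r *m invmx M.
exists (w0 + \sum_i x 0 i *: g i); apply: (antilinear_eq eP) => //.
- exact: bs.2.
- by move=> m; rewrite sesquiDl// gM mulmxKV// mxE addrC subrK.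
- by move=> v Wv; rewrite sesquiDl// gW// addr0 w0P.
Qed.

Lemma continuous_bounded_form (b : V -> V -> K) : sesquilinear b ->
  continuous (fun p : V * V => b p.1 p.2) -> bounded_form b.
Proof.
move=> bs /(_ (0, 0)) /cvgrPdist_lt /(_ 1 ltr01) /nbhs_ballP[d /= d0 hd].
pose r := d / 2.
have r0 : 0 < r by rewrite divr_gt0.
have rd : r < d by rewrite ltr_pdivrMr// ltr_pMr// ltr1n.
exists (r ^- 2) => [|u v]; first by rewrite invr_ge0 exprn_ge0// ltW.
have [->|u0] := eqVneq u 0.
  by rewrite sesqui0l// !normr0 mulr0 mul0r.
have [->|v0] := eqVneq v 0.
  by rewrite (antilinear0 (bs.2 _)) !normr0 mulr0.
have un : 0 < `|u| by rewrite normr_gt0.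
have vn : 0 < `|v| by rewrite normr_gt0.
have cp (w : V) : 0 < `|w| -> conj (r / `|w|) = r / `|w|.
  by move=> wn; rewrite scalar_conj_ge0// divr_ge0// ltW.
have bl (w : V) : 0 < `|w| -> ball 0 d ((r / `|w|) *: w).
  move=> wn; rewrite -ball_normE /= sub0r normrN normrZ gtr0_norm ?divr_gt0//.
  by rewrite divfK ?gt_eqF.
have /hd /= : ball ((0, 0) : V * V) d ((r / `|u|) *: u, (r / `|v|) *: v).
  by split; exact: bl.
rewrite sesqui0l// sub0r normrN sesquiZl// (antilinearZ (bs.2 _)) cp//.
rewrite normrM [X in X * _]gtr0_norm ?divr_gt0//.
rewrite normrM [X in _ * (X * _)]gtr0_norm ?divr_gt0// => /ltW h.
rewrite -mulrA ler_pdivlMl ?exprn_gt0//.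
rewrite -[leRHS]mul1r -ler_pdivrMr ?mulr_gt0//; apply: le_trans h.
have E (F : comNzRingType) (x B U W : F) :
  x ^+ 2 * B * (U * W) = x * U * (x * W * B) by ring.
by rewrite invfM E.
Qed.
End Solve.

Section NumericalRange.
Context {R : realType} {k : scalar_kind} {V H : hilbertType R k}.
Variables (a : sesquilinear_form V) (j : {linear V -> H}).
Local Notation K := (scalars R k).
Local Notation W := (numerical_range a j).
Local Notation A := (associated_operator a j).

Lemma bundled_sesquilinear : sesquilinear a.
Proof.
by split=> [t u u' v|u t v v']; [rewrite linearPl|rewrite linearPr].
Qed.

Lemma shifted_form_sesquilinear mu : sesquilinear (shifted_form a j mu).
Proof.
have S := @inner_sesquilinear R k H; have aS := bundled_sesquilinear.
rewrite /shifted_form; split=> [t u u' v|u t v v'] /=.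
  by rewrite aS.1 linearP S.1 mulrDr opprD addrACA mulrBr mulrCA.
by rewrite aS.2 linearP S.2 mulrDr opprD addrACA mulrBr mulrCA.
Qed.

Lemma linear_continuous_bound : continuous j ->
  exists2 M : K, 0 <= M & forall v, `|j v| <= M * `|v|.
Proof.
move=> jc; have /linear_boundedP := continuous_linear_bounded 0 (jc 0).
by move=> /pinfty_ex_gt0[M M0 hM]; exists M; [exact: ltW|exact: hM].
Qed.

Lemma shifted_form_bounded mu : continuous j -> bounded_form a ->
  bounded_form (shifted_form a j mu).
Proof.
move=> /linear_continuous_bound[M M0 jM] [N N0 aN].
exists (N + `|mu| * M ^+ 2) => [|u v].
  by rewrite addr_ge0// mulr_ge0// exprn_ge0.
apply: le_trans (ler_normB _ _) _; rewrite 2!mulrDl lerD//.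
rewrite normrM -!(mulrA `|mu|) ler_wpM2l//; apply: le_trans (cauchy_schwarz _ _) _.
apply: le_trans (ler_pM _ _ (jM u) (jM v)) _ => //.
by rewrite mulrACA -expr2 mulrA.
Qed.

Lemma shifted_form_coercive mu delta : 0 <= delta ->
  (forall w, W w -> delta <= `|mu - w|) ->
  forall u, delta * `|j u| ^+ 2 <= `|shifted_form a j mu u u|.
Proof.
move=> d0 dW u; have aS := bundled_sesquilinear.
have [ju0|ju0] := eqVneq (j u) 0.
  by rewrite ju0 normr0 expr0n/= mulr0.
have n0 : 0 < `|j u| by rewrite normr_gt0.
have n2 : 0 < `|j u| ^+ 2 by rewrite exprn_gt0.
have /dW : W (`|j u| ^- 2 * a u u).
  exists (`|j u|^-1 *: u) => /=.
    by rewrite linearZ normrZ gtr0_norm ?invr_gt0// mulVf// gt_eqF.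
  rewrite (sesquiZl aS) (antilinearZ (aS.2 _)) scalar_conj_ge0 ?invr_ge0//.
  by rewrite mulrA -invfM -expr2.
move=> dw; have := ler_wpM2r (ltW n2) dw; move=> /le_trans; apply.
rewrite -[X in _ * X](gtr0_norm n2) -normrM mulrBl mulrAC mulVf ?gt_eqF// mul1r.
by rewrite /shifted_form innerxx distrC.
Qed.

Lemma resolvent_equation mu x f : mu_minus mu A (x, f) <->
  exists2 u, j u = x & forall v, shifted_form a j mu u v = - inner f (j v).
Proof.
have S := @inner_sesquilinear R k H; rewrite /shifted_form; split.
  move=> [y [u [/= jux uy]] /= ->]; exists u => // v.
  by rewrite uy jux (sesquiBl S) (sesquiZl S) opprB.
move=> [u jux uf]; exists (mu *: x - f) => /=; last by rewrite opprB addrC subrK.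
exists u; split=> // v; rewrite (sesquiBl S) (sesquiZl S) /= -jux.
by rewrite -uf addrC subrK.
Qed.

Lemma resolvent_bound mu delta x f : 0 <= delta ->
  (forall w, W w -> delta <= `|mu - w|) ->
  mu_minus mu A (x, f) -> delta * `|x| <= `|f|.
Proof.
move=> d0 dW /resolvent_equation[u <- uf].
have := shifted_form_coercive d0 dW u; rewrite uf normrN.
have [->|ju0] := eqVneq (j u) 0; first by rewrite normr0 mulr0.
move=> /le_trans/(_ (cauchy_schwarz _ _)).
by rewrite expr2 mulrA ler_pM2r// normr_gt0.
Qed.

Lemma closure_gap mu : ~ closure W mu ->
  exists2 delta : K, 0 < delta & forall w, W w -> delta <= `|mu - w|.
Proof.
move=> /existsNP[B /not_implyP[/nbhs_ballP[d /= d0 dB] WB]].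
exists d => // w Ww; rewrite real_leNgt ?normr_real ?ger0_real ?ltW//.
apply/negP => wd; apply: WB; exists w; split=> //; apply: dB.
by rewrite -ball_normE.
Qed.

Lemma resolvent_equation_solvable mu f :
  continuous j -> continuous (fun p : V * V => a p.1 p.2) ->
  (forall u, j u = 0 -> (forall v, j v = 0 -> a u v = 0) -> u = 0) ->
  (exists lambda, essentially_coercive (shifted_form a j lambda)) ->
  ~ closure W mu -> exists x, mu_minus mu A (x, f).
Proof.
move=> jc ac aker [lambda ess] /closure_gap[d d0 dW].
have aS := bundled_sesquilinear.
pose b := shifted_form a j mu.
have bc u : d * `|j u| ^+ 2 <= `|b u u| := shifted_form_coercive (ltW d0) dW u.
have bs : sesquilinear b := shifted_form_sesquilinear mu.
have bb : bounded_form b.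
  by apply: shifted_form_bounded => //; exact: continuous_bounded_form.
have binj u : (forall v, b u v = 0) -> u = 0.
  move=> bu0; have ju0 : j u = 0.
    apply/eqP; rewrite -normr_eq0 -sqrf_eq0 eq_le exprn_ge0// andbT.
    by rewrite -(pmulr_rle0 _ d0); have := bc u; rewrite bu0 normr0.
  apply: aker => // v jv0; have := bu0 v.
  by rewrite /b /shifted_form ju0 (sesqui0l inner_sesquilinear) mulr0 subr0.
have [u uP bu0|n [e [c [eP c0 ec]]]] := finite_codim_coercive bs.
  have ju0 : `|j (u n)| ^+ 2 @[n --> \oo] --> (0 : K).
    apply/(@cvg_seqP _ _ K^o) => e e0.
    have [N hN] := (@cvg_seqP _ _ K^o _ _).1 bu0 _ (mulr_gt0 d0 e0).
    exists N => n /hN; rewrite !sub0r !normrN => h.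
    rewrite ger0_norm ?exprn_ge0// -(ltr_pM2l d0).
    exact: le_lt_trans (bc _) h.
  have : shifted_form a j lambda (u n) (u n) @[n --> \oo] --> (0 : K).
    rewrite (_ : (fun n => _) = fun n =>
        b (u n) (u n) + (mu - lambda) * `|j (u n)| ^+ 2); last first.
      apply/funext => n; rewrite /b /shifted_form innerxx mulrBl addrA.
      by rewrite subrK.
    have := cvgD bu0 (cvgM (cvg_cst (mu - lambda)) ju0).
    by rewrite mulr0 addr0; apply.
  move=> /(ess u (orthonormal_weakly_cvg uP)).
  rewrite (_ : (fun n => `|u n|) = fun=> 1) => [u1|].
    have h : (0 : K) = 1 := cvg_seq_unique (W := K^o) u1 (cvg_cst (1 : K^o)).
    by have := oner_neq0 K; rewrite -h eqxx.
  by apply/funext => n; exact: orthonormal_norm uP.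
have S := @inner_sesquilinear R k H.
have phiP : antilinear (fun v => - inner f (j v)).
  by move=> t u v; rewrite linearP S.2 opprD mulrN.
have phiB : bounded_functional (fun v => - inner f (j v)).
  have [M M0 jM] := linear_continuous_bound jc.
  exists (`|f| * M) => [|v]; first by rewrite mulr_ge0.
  rewrite normrN; apply: le_trans (cauchy_schwarz _ _) _.
  by rewrite -mulrA ler_wpM2l.
have [u uP] := form_surjective bs bb eP c0 ec binj phiP phiB.
by exists (j u); apply/resolvent_equation; exists u.
Qed.

Lemma resolvent_graph_unique mu x y f : ~ closure W mu ->
  mu_minus mu A (x, f) -> mu_minus mu A (y, f) -> x = y.
Proof.
move=> /closure_gap[d d0 dW] /resolvent_equation[u <- uf].
move=> /resolvent_equation[v <- vf].
have S := shifted_form_sesquilinear mu.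
have /(resolvent_bound (ltW d0) dW) : mu_minus mu A (j u - j v, 0).
  apply/resolvent_equation; exists (u - v); first by rewrite linearB.
  move=> w; rewrite (sesquiBl S) uf vf subrr.
  by rewrite (sesqui0l inner_sesquilinear) oppr0.
rewrite normr0 pmulr_rle0// normr_le0 subr_eq0.
by move=> /eqP.
Qed.

Lemma numerical_range_resolvent mu : ~ closure W mu ->
  (forall f, exists x, mu_minus mu A (x, f)) ->
  resolvent_set A mu.
Proof.
move=> muW /choice[T TP]; have [d d0 dW] := closure_gap muW.
have S := shifted_form_sesquilinear mu.
have IS := @inner_sesquilinear R k H.
have Tlin : linear T.
  move=> t f g; apply: (resolvent_graph_unique muW (TP _)).
  have /resolvent_equation[u uf uP] := TP f.
  have /resolvent_equation[v vg vP] := TP g.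
  apply/resolvent_equation; exists (t *: u + v); first by rewrite linearP uf vg.
  by move=> w; rewrite S.1 uP vP IS.1 opprD mulrN.
pose TL : {linear H -> H} := HB.pack T (GRing.isLinear.Build _ _ _ _ T Tlin).
exists TL.
  apply: bounded_linear_continuous; apply/linear_boundedP.
  near=> r => f; rewrite (@le_trans _ _ (d^-1 * `|f|))//.
    by rewrite ler_pdivlMl//; exact: (resolvent_bound (ltW d0) dW (TP f)).
  apply: ler_wpM2r => //; near: r; apply: nbhs_pinfty_ge.
  by rewrite ger0_real// invr_ge0 ltW.
move=> f x; split=> [<-|]; first exact: TP.
exact: (resolvent_graph_unique muW (TP f)).
Unshelve. all: by end_near.
Qed.

Lemma operator_norm_resolvent mu : ~ closure W mu ->
  (forall f, exists x, mu_minus mu A (x, f)) ->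
  (operator_norm (resolvent mu A) <= (dist_to mu W)^-1)%E.
Proof.
move=> muW ex; apply: ge_ereal_sup => _ [f /= f1 <-].
have /(xgetPex 0) : exists x, mu_minus mu A (x, f) := ex f.
rewrite -/(resolvent mu A f); move: (resolvent _ _ _) => x /= xf.
have [d d0 dW] := closure_gap muW.
have rd0 : 0 < scalar_re d by rewrite -(@scalar_emb_gt0 R k) scalar_reK ?ltW.
have : ((scalar_re d)%:E <= dist_to mu W)%E.
  apply: le_ereal_inf_tmp => _ [w Ww <-].
  by rewrite lee_fin ler_scalar_re// ?dW// ltW.
case E : (dist_to mu W) => [r| |].
- rewrite lee_fin => /(lt_le_trans rd0) r0.
  rewrite inver gt_eqF// lee_fin -[_^-1]mul1r ler_pdivlMr//.
  rewrite -(@ler_scalar_emb R k) scalar_embM scalar_reK// (scalar_emb_nat 1) mulrC.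
  apply: le_trans f1; apply: (resolvent_bound _ _ xf).
    by rewrite scalar_emb_ge0 ltW.
  move=> w Ww; rewrite -[`|mu - w|](@scalar_reK R k)// ler_scalar_emb -lee_fin -E.
  by apply: ereal_inf_lbound; exists w.
- move=> _; rewrite invey lee_fin.
  have [->|x0] := eqVneq x 0.
    by rewrite -(@ler_scalar_emb R k) scalar_reK ?normr0// (scalar_emb_nat 0).
  have n0 : 0 < `|x| by rewrite normr_gt0.
  have : 2 / `|x| * `|x| <= `|f|.
    apply: (resolvent_bound _ _ xf); first by rewrite divr_ge0.
    move=> w Ww; have : (dist_to mu W <= (scalar_re `|mu - w|)%:E)%E.
      by apply: ereal_inf_lbound; exists w.
    by rewrite E.
  rewrite divfK ?gt_eqF// => /le_trans/(_ f1).
  by rewrite (ler_nat K 2 1).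
- by rewrite leeNy_eq.
Qed.
End NumericalRange.

Unset Implicit Arguments.

(* In [(dist_to mu W)^-1%E] the library conventions are 0^-1 = +oo and
   +oo^-1 = 0. *)
Theorem theorem2p3 (R : realType) (k : scalar_kind) (V H : hilbertType R k)
    (j : {linear V -> H}) (a : sesquilinear_form V)
    (j_continuous : continuous j)
    (j_dense : dense (range j))
    (a_continuous : continuous (fun p : V * V => a p.1 p.2))
    (a_ker : forall u : V, j u = 0 ->
       (forall v : V, j v = 0 -> a u v = 0) -> u = 0)
    (a_coercive : exists lambda : scalars R k,
       essentially_coercive (shifted_form a j lambda)) :
  spectrum (associated_operator a j) `<=` closure (numerical_range a j) /\
  forall mu : scalars R k, ~ closure (numerical_range a j) mu ->
    (operator_norm (resolvent mu (associated_operator a j)) <=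
       (dist_to mu (numerical_range a j))^-1)%E.
Proof.
have solvable mu f : ~ closure (numerical_range a j) mu ->
    exists x, mu_minus mu (associated_operator a j) (x, f).
  exact: resolvent_equation_solvable.
split=> [mu spec_mu|mu muW].
  apply: contrapT => muW; apply: spec_mu.
  by apply: numerical_range_resolvent => // f; exact: solvable.
by apply: operator_norm_resolvent => // f; exact: solvable.
Qed.
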